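(* Every weakly reversible ring is abelian, i.e., all of its idempotents are central.
   Context: All rings are associative with identity, not necessarily commutative. For $a\in R$, $r_R(a)=\{b\in R: ab=0\}$ and $l_R(a)=\{b\in R: ba=0\}$. An element $a\in R$ is reversible if $l_R(a)=r_R(a)$. A ring $R$ is weakly reversible if for each non-zero $a\in R$ there is an integer $m>0$ such that $a^m$ is a non-zero reversible element of $R$. *)

(* Defs.v *)
From mathcomp Require Import all_boot all_algebra.

Set Implicit Arguments.
Unset Strict Implicit.
Unset Printing Implicit Defensive.

Import GRing.Theory.
Local Open Scope ring_scope.

(* [pzRingType] is the class of associative unital rings, not necessarily
   commutative; unlike [nzRingType] it does not exclude the zero ring. *)

Definition right_annihilator (R : pzRingType) (a : R) : {pred R} :=
  [pred b | a * b == 0].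

Definition left_annihilator (R : pzRingType) (a : R) : {pred R} :=
  [pred b | b * a == 0].

Definition reversible_elt (R : pzRingType) (a : R) : Prop :=
  left_annihilator a =i right_annihilator a.

Definition weakly_reversible (R : pzRingType) : Prop :=
  forall a : R, a != 0 ->
    exists m : nat, [/\ (0 < m)%N, a ^+ m != 0 & reversible_elt (a ^+ m)].

Definition idempotent_elt (R : pzRingType) (e : R) : Prop := e * e = e.

Definition central_elt (R : pzRingType) (c : R) : Prop :=
  forall x : R, GRing.comm c x.

Definition abelian_ring (R : pzRingType) : Prop :=
  forall e : R, idempotent_elt e -> central_elt e.

(* Main.v *)
Require Import Defs.
From mathcomp Require Import all_boot all_algebra.

Import GRing.Theory.
Local Open Scope ring_scope.

(** All positive powers of an idempotent [e] coincide with [e], so for [e != 0] weak reversibility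
    makes [e] itself reversible. Reversibility then kills both off-diagonal Peirce components
    [e x (1 - e)] and [(1 - e) x e] of every [x], which is centrality
    ([reversible_idempotent_central]). *)

Lemma idempotent_expr (R : pzRingType) (e : R) (m : nat) :
  idempotent_elt e -> (0 < m)%N -> e ^+ m = e.
Proof.
move=> ee; case: m => // m _.
by elim: m => [|m IHm]; rewrite ?expr1 // exprS IHm.
Qed.

(* From [x (1 - e) e = 0] and [e (1 - e) x = 0], reversibility gives
   [e x (1 - e) = 0] and [(1 - e) x e = 0], so [e x = e x e = x e]. *)
Lemma reversible_idempotent_central (R : pzRingType) (e : R) :
  idempotent_elt e -> reversible_elt e -> central_elt e.
Proof.
move=> ee rev_e x.
have rev b : (b * e == 0) = (e * b == 0) by have := rev_e b; rewrite !inE.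
have /eqP: e * (x - x * e) == 0 by rewrite -rev mulrBl -mulrA ee subrr.
rewrite mulrBr mulrA => /subr0_eq ex.
have /eqP: (x - e * x) * e == 0 by rewrite rev mulrBr mulrA ee subrr.
by rewrite mulrBl => /subr0_eq xe; rewrite /GRing.comm ex xe.
Qed.

Theorem proposition2p6 (R : pzRingType) (hR : weakly_reversible R) :
  abelian_ring R.
Proof.
(* Weak reversibility only speaks of nonzero elements, so [e = 0] is settled directly. *)
move=> e ee; have [-> x | e_neq0] := eqVneq e 0.
  by rewrite /GRing.comm mul0r mulr0.
have [m [m_gt0 _]] := hR e e_neq0.
rewrite (idempotent_expr _ _ _ ee m_gt0).
exact: reversible_idempotent_central.
Qed.
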